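(* Let $f$ be the FR-function of a closed subspace $\mathscr{H}_0\subset\mathscr{H}$ with respect to a self-adjoint operator $T\colon\mathscr{D}(T)\to\mathscr{H}$ on a complex Hilbert space $\mathscr{H}$. Then $f$ is a Nevanlinna function (with values in $\mathfrak{B}(\mathscr{H}_0)$) in any of the following cases: (i) $\dim\mathscr{H}_0<\infty$; (ii) $\mathscr{H}_0\subset\mathscr{D}(T)$.
   Context: $T$ may be unbounded. $\mathfrak{B}(X)$ denotes the bounded linear operators defined on all of $X$. For a linear operator $S\colon\mathscr{D}(S)\to X$, $\varpi(S)=\{\lambda\in\mathbb{C}:\ker(\lambda-S)=\{0\},\ \mathrm{Range}(\lambda-S)=X\}$. Let $P$ be the orthogonal projection of $\mathscr{H}$ onto $\mathscr{H}_0$ and $Q=1-P$. The FR-function of $\mathscr{H}_0$ with respect to $T$ is $f(z)=PT(1-zQT)^{-1}P$, regarded as an operator on $\mathscr{H}_0$, defined for $z^{-1}\in\varpi(QT)$ ($QT$ has domain $\mathscr{D}(T)$). A Nevanlinna function with values in $\mathfrak{B}(\mathscr{H}_0)$ is an analytic function $f\colon\mathbb{C}\setminus\mathbb{R}\to\mathfrak{B}(\mathscr{H}_0)$ (in particular defined at every $z\in\mathbb{C}\setminus\mathbb{R}$) such that $f(z)^\dagger=f(\overline z)$ and $\operatorname{Im}f(z)/\operatorname{Im}z\ge0$ for all $z\in\mathbb{C}\setminus\mathbb{R}$, where $\operatorname{Im}A=(A-A^\dagger)/(2i)$ and $A^\dagger$ is the adjoint. *)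

(* Defs.v *)
From HB Require Import structures.
From mathcomp Require Import all_boot all_order all_algebra.
From mathcomp Require Import complex sesquilinear.
From mathcomp Require Import boolp classical_sets reals topology normedtype.

Set Implicit Arguments.
Unset Strict Implicit.
Unset Printing Implicit Defensive.

Import Order.TTheory GRing.Theory Num.Theory.
Import numFieldNormedType.Exports.

Local Open Scope classical_set_scope.
Local Open Scope ring_scope.

(* Possibly unbounded operators in H.  The values of [oapp] outside [odom] are
   irrelevant: they are never used below, and [op_eq] ignores them. *)
Record operator (H : Type) := Operator {
  odom : set H;
  oapp :> H -> H
}.

Definition op_eq (H : Type) (A B : operator H) : Prop :=
  odom A = odom B /\ forall x, odom A x -> A x = B x.

Section OperatorCalculus.
Variables (C : numClosedFieldType) (H : lmodType C).
Implicit Types (A B S : operator H) (X : set H).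

Definition linear_subspace X : Prop := submod_closed (mem X).

Definition linear_op A : Prop :=
  linear_subspace (odom A) /\
  forall a x y, odom A x -> odom A y -> A (a *: x + y) = a *: A x + A y.

Definition op1 : operator H := Operator setT id.
Definition op_sub A B : operator H :=
  Operator (odom A `&` odom B) (fun x => A x - B x).
Definition op_scale (a : C) A : operator H :=
  Operator (odom A) (fun x => a *: A x).
Definition op_comp A B : operator H :=
  Operator (odom B `&` [set x | odom A (B x)]) (fun x => A (B x)).
Definition op_restr X A : operator H := Operator (odom A `&` X) A.

Definition op_ker A : set H := [set x | odom A x /\ A x = 0].
Definition op_range A : set H := A @` odom A.

(* Meaningful for injective A only. *)
Definition op_inv A : operator H :=
  Operator (op_range A) (fun y => xget 0 [set x | odom A x /\ A x = y]).

Definition varpi S : set C :=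
  [set l | op_ker (op_sub (op_scale l op1) S) = [set 0] /\
           op_range (op_sub (op_scale l op1) S) = setT].

Definition finite_dimensional X : Prop :=
  exists (n : nat) (e : 'I_n -> H),
    X = [set \sum_(i < n) c i *: e i | c in [set: 'I_n -> C]].

End OperatorCalculus.

Declare Scope op_scope.
Delimit Scope op_scope with OP.
Bind Scope op_scope with operator.
Arguments op1 {C H}.
Arguments op_sub {C H} (A B)%_OP.
Arguments op_scale {C H} a%_R A%_OP.
Arguments op_comp {C H} (A B)%_OP.
Notation "1" := op1 : op_scope.
Notation "A - B" := (op_sub A B) : op_scope.
Notation "a *: A" := (op_scale a A) : op_scope.
Notation "A \o B" := (op_comp A B) : op_scope.

(* The Hilbert space is a complete normed module H over R[i] with an inner
   product [ip], linear in its first argument, inducing the norm of H. *)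
Section Hilbert.
Variables (R : realType) (H : completeNormedModType R[i]).
Variable ip : {dot H for (@Num.conj R[i])}.
Implicit Types (A T : operator H) (X : set H).

Definition induces_norm : Prop := forall x : H, ip x x = `|x| ^+ 2.

(* Adjoint of A, regarded as an operator in the closed subspace X.  The value
   is uniquely determined when [odom A] is dense in X. *)
Definition adjoint X A : operator H :=
  let R y := [set w | X w /\ forall x, odom A x -> ip (A x) y = ip x w] in
  Operator [set y | X y /\ R y !=set0] (fun y => xget 0 (R y)).

Definition self_adjoint T : Prop :=
  [/\ linear_op T, dense (odom T) & op_eq T (adjoint setT T)].

(* The operator norm of A on X is at most M. *)
Definition opnorm_le X A (M : R[i]) : Prop :=
  forall x, X x -> `|A x| <= M * `|x|.

(* A belongs to B(X). *)
Definition bounded_op X A : Prop :=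
  [/\ linear_op A, odom A = X, (forall x, X x -> X (A x)) &
      exists M, opnorm_le X A M].

Definition op_pos A : Prop := forall x, odom A x -> 0 <= ip (A x) x.

Definition op_Im X A : operator H := ((2 * 'i)^-1 *: (A - adjoint X A))%OP.

Definition orthoproj X : operator H :=
  Operator setT
    (fun x => xget 0 [set p | X p /\ forall h, X h -> ip (x - p) h = 0]).

Definition FR_dom X T : set R[i] :=
  [set z | z != 0 /\ varpi ((1 - orthoproj X) \o T) z^-1].

(* P T (1 - z Q T)^-1 P as an operator on X, for z in [FR_dom X T]. *)
Definition FR X T (z : R[i]) : operator H :=
  let P := orthoproj X in
  let Q := (1 - P)%OP in
  op_restr X (P \o T \o op_inv (1 - z *: (Q \o T)) \o P).

Definition nonreal : set R[i] := [set z | 'Im z != 0].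

(* Complex differentiability on the open set U, in the operator norm of B(X). *)
Definition analytic_op X (U : set R[i]) (f : R[i] -> operator H) : Prop :=
  forall z, U z -> exists2 L, bounded_op X L &
    forall e : R[i], 0 < e ->
    exists2 d : R[i], 0 < d &
      forall w, w != z -> `|w - z| < d ->
        opnorm_le X ((w - z)^-1 *: (f w - f z) - L) e.

(* [f], meaningful on the set [D] only, is (after restriction to the nonreal
   numbers) a Nevanlinna function with values in B(X). *)
Definition nevanlinna X (D : set R[i]) (f : R[i] -> operator H) : Prop :=
  [/\ nonreal `<=` D,
      forall z, nonreal z -> bounded_op X (f z),
      analytic_op X nonreal f,
      forall z, nonreal z -> op_eq (adjoint X (f z)) (f (Num.conj z)) &
      forall z, nonreal z -> op_pos (('Im z)^-1 *: op_Im X (f z))].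

End Hilbert.

(* Main.v *)
Require Import Defs.
From mathcomp Require Import all_boot all_order all_algebra.
From mathcomp Require Import complex sesquilinear.
From mathcomp Require Import boolp classical_sets reals topology normedtype.
From mathcomp Require Import ring lra.

(** Let [l = 1/z] with [z] nonreal, and let [h = P T x] be the component of [T x]
    in [H0]. The equation [(1 - z Q T) x = y] reads [(l - T) x = l y - h], so
    that [x] is the resolvent of [T] at [l y - h], and the only constraint on
    [h] in [H0] is [P x = P y]. Solving the equation for every [y] therefore
    amounts to inverting the compression [P (l - T)^-1] of the resolvent to
    [H0]. As [T] is symmetric,
      [|Im l| |(l - T)^-1 h|^2 <= |(P (l - T)^-1 h, h)|],
    so the compression is coercive, hence boundedly invertible
    ([compressed_resolvent_surj]), once [|h| <= c |(l - T)^-1 h|] on [H0]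
    ([shift_le_on]). This is where the two cases enter. If [H0] has finite
    dimension, [l - T] is bounded on the finite-dimensional space
    [(l - T)^-1 H0] ([shift_le_on_finite_dim]). If [H0] lies in the domain of
    [T], then [T] is bounded on [H0] by uniform boundedness
    ([bounded_on_subdomain]) and [|h|^2 = ((l - T)^-1 h, (l^* - T) h)]
    ([shift_le_on_subdomain]). The rest of the argument does not distinguish the
    cases.

    The existence statements about vectors (orthogonal projections, resolvents,
    and the inverse of the compression) all come from one form of the Riesz
    theorem, [riesz_param], where the functional is given through a
    parametrization of the subspace on which it is defined.

    Once [x = (1 - z Q T)^-1 y] exists with [|T x| <= b |y|] ([FR_solve]), the
    Nevanlinna properties are formal. The identity
      [(f(w) h, g) - (h, f(z^* ) g) = (w - z) (Q T x, Q T y)]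
    ([FR_form]) contains the symmetry and the positivity. Analyticity
    ([FR_analytic]) is the resolvent expansion of [P T (1 - w Q T)^-1] around
    [z], with derivative [P T (1 - z Q T)^-1 Q T (1 - z Q T)^-1]. *)

Set Implicit Arguments.
Unset Strict Implicit.
Unset Printing Implicit Defensive.

Import Order.TTheory GRing.Theory Num.Theory.
Import numFieldNormedType.Exports.

Local Open Scope classical_set_scope.
Local Open Scope ring_scope.

(** * Real-valued norms and complex scalars *)

Section RealNorm.
Variables (R : realType).

(** The norm of a space over [R[i]] is [R[i]]-valued; its real part lives in a
    totally ordered field, where infima and linear arithmetic are available. *)
Definition rnorm (V : normedZmodType R[i]) (x : V) : R := complex.Re `|x|.

Lemma rnormE (V : normedZmodType R[i]) (x : V) :
  `|x| = (rnorm x)%:C%C.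
Proof. by rewrite /rnorm RRe_real// ger0_real. Qed.

Lemma rnorm_ge0 (V : normedZmodType R[i]) (x : V) : 0 <= rnorm x.
Proof. by rewrite -ler0c -rnormE. Qed.

Lemma rnormD (V : normedZmodType R[i]) (x y : V) :
  rnorm (x + y) <= rnorm x + rnorm y.
Proof. by rewrite -lecR rmorphD/= -!rnormE ler_normD. Qed.

Lemma rnormN (V : normedZmodType R[i]) (x : V) : rnorm (- x) = rnorm x.
Proof. by rewrite /rnorm normrN. Qed.

Lemma rnormBC (V : normedZmodType R[i]) (x y : V) :
  rnorm (x - y) = rnorm (y - x).
Proof. by rewrite /rnorm distrC. Qed.

Lemma rnormB (V : normedZmodType R[i]) (x y : V) :
  rnorm (x - y) <= rnorm x + rnorm y.
Proof. by rewrite (le_trans (rnormD _ _))// rnormN. Qed.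

Lemma rnorm0 (V : normedZmodType R[i]) : rnorm (0 : V) = 0.
Proof. by rewrite /rnorm normr0. Qed.

Lemma ltr0c (t : R) : (0 < t%:C%C :> R[i]) = (0 < t).
Proof. by rewrite -ltcR. Qed.

Lemma rnorm_le0 (V : normedZmodType R[i]) (x : V) : rnorm x <= 0 -> x = 0.
Proof.
move=> x0; apply/eqP; rewrite -normr_le0 rnormE.
by rewrite -[0]/((0:R)%:C%C) lecR.
Qed.

Lemma rnormZ (V : normedModType R[i]) (a : R[i]) (x : V) :
  rnorm (a *: x) = rnorm a * rnorm x.
Proof. by apply: complexI; rewrite rmorphM/= -!rnormE normrZ. Qed.

Lemma rnormM (a b : R[i]) : rnorm (a * b) = rnorm a * rnorm b.
Proof. by apply: complexI; rewrite rmorphM/= -!rnormE normrM. Qed.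

Lemma rnorm_conj (a : R[i]) : rnorm (Num.conj a) = rnorm a.
Proof. by rewrite /rnorm norm_conjC. Qed.

Lemma rnorm_real (t : R) : 0 <= t -> rnorm (t%:C%C) = t.
Proof. by move=> t0; rewrite /rnorm ger0_norm ?ler0c. Qed.

Lemma rnorm_gt0 (V : normedZmodType R[i]) (x : V) : x != 0 -> 0 < rnorm x.
Proof.
by move=> x0; rewrite lt_def rnorm_ge0 andbT; apply: contraNN x0 => /eqP x0;
  apply/eqP/rnorm_le0; rewrite x0.
Qed.

Lemma Re_le_rnorm (a : R[i]) : complex.Re a <= rnorm a.
Proof.
by rewrite -lecR -rnormE (le_trans _ (normc_ge_Re a))// lecR ler_norm.
Qed.

Lemma Im_le_rnorm (a : R[i]) : `|complex.Im a| <= rnorm a.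
Proof.
rewrite -lecR -rnormE normc_def lecR -sqrtr_sqr; apply: ler_wsqrtr.
by rewrite lerDr sqr_ge0.
Qed.
Lemma Re_conj (a : R[i]) : complex.Re (Num.conj a) = complex.Re a.
Proof. by case: a. Qed.
Lemma Im_conj (a : R[i]) : complex.Im (Num.conj a) = - complex.Im a.
Proof. by case: a. Qed.

Lemma ReD (a b : R[i]) : complex.Re (a + b) = complex.Re a + complex.Re b.
Proof. by case: a b => [? ?] []. Qed.
Lemma ImD (a b : R[i]) : complex.Im (a + b) = complex.Im a + complex.Im b.
Proof. by case: a b => [? ?] []. Qed.
Lemma ReN (a : R[i]) : complex.Re (- a) = - complex.Re a.
Proof. by case: a. Qed.
Lemma ImN (a : R[i]) : complex.Im (- a) = - complex.Im a.
Proof. by case: a. Qed.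
Lemma ReZ (t : R) (a : R[i]) : complex.Re (t%:C%C * a) = t * complex.Re a.
Proof. by case: a => x y /=; rewrite mul0r subr0. Qed.
Lemma ImZ (t : R) (a : R[i]) : complex.Im (t%:C%C * a) = t * complex.Im a.
Proof. by case: a => x y /=; rewrite mul0r addr0. Qed.

Lemma Im_inv_neq0 (z : R[i]) : complex.Im z != 0 -> complex.Im z^-1 != 0.
Proof.
have realE (w : R[i]) : (w \is Num.real) = (complex.Im w == 0).
  by case: w => a b; rewrite complex_real.
by rewrite -!realE realV.
Qed.

Lemma nonrealE (z : R[i]) : nonreal z <-> complex.Im z != 0.
Proof.
rewrite /nonreal/= -complexIm; split; apply: contraNN => /eqP.
  by move=> ->.
by move=> /complexI ->.
Qed.

End RealNorm.

(** * Limits and subspaces *)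

(** Completeness of [H] in the form used below: an explicit modulus of
    convergence is carried over to the limit. *)
Lemma complete_lim (R : realType) (H : completeNormedModType R[i]) (X : set H)
    (x : nat -> H) (e : nat -> R) :
  closed X -> (forall k, X (x k)) ->
  (forall k l, (k <= l)%N -> rnorm (x k - x l) <= e k) ->
  (forall d, 0 < d -> exists k, e k < d) ->
  exists2 y, X y & forall k, rnorm (x k - y) <= e k.
Proof.
move=> cX Xx xe e0.
have e_ge0 k : 0 <= e k by rewrite (le_trans _ (xe k k _))// rnorm_ge0.
have : cvg (x @ \oo).
  apply: cauchy_cvg; apply: cauchy_exP => d d0; rewrite /fmapE -ball_normE.
  have dR : d = (complex.Re d)%:C%C by rewrite RRe_real// gtr0_real.
  have [|k ekd] := e0 (complex.Re d); first by rewrite -ltcR -dR.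
  exists (x k); exists k => // l /= kl.
  by rewrite /ball_/= rnormE dR ltcR (le_lt_trans (xe _ _ kl)).
move=> /cvg_ex[y xy]; exists y.
  by apply: (closed_cvg X cX _ y xy); exact: nearW.
move=> k; apply/ler_addgt0Pr => d d0.
have dC : 0 < d%:C%C :> R[i] by rewrite ltr0c.
move/cvgrPdist_lt : xy => /(_ _ dC)[N _ NP].
have := NP (maxn k N) (leq_maxr _ _).
rewrite /= rnormE ltcR => yx.
rewrite -(subrKA (x (maxn k N))) (le_trans (rnormD _ _))// lerD//.
  by rewrite xe// leq_maxl.
by rewrite rnormBC ltW.
Qed.

Lemma harmonic_lt (R : realType) (d : R) : 0 < d -> exists k : nat, k.+1%:R^-1 < d.
Proof.
move=> d0; exists (Num.truncn d^-1).
by rewrite invf_plt ?posrE// truncnS_gt.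
Qed.

Lemma le_of_harmonic (R : realType) (x y c : R) :
  (forall k : nat, x <= y + c / k.+1%:R) -> x <= y.
Proof.
move=> xy; apply/ler_addgt0Pr => d d0.
have c1 : 0 < `|c| + 1 by rewrite ltr_wpDl.
have [|k kd] := @harmonic_lt R (d / (`|c| + 1)); first exact: divr_gt0.
apply: (le_trans (xy k)); rewrite lerD2l.
apply: (@le_trans _ _ ((`|c| + 1) / k.+1%:R)).
  by rewrite ler_pM2r ?invr_gt0// (le_trans (ler_norm _))// lerDl.
by rewrite mulrC -ler_pdivlMr// ltW.
Qed.

Section LinearOn.
Variables (C : numClosedFieldType) (V W : lmodType C).
Implicit Types (X : set V).

Definition linear_on X (f : V -> W) :=
  forall a x y, X x -> X y -> f (a *: x + y) = a *: f x + f y.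

Lemma subspaceP X : linear_subspace X <->
  X 0 /\ forall a x y, X x -> X y -> X (a *: x + y).
Proof.
split=> [[X0 XZ]|[X0 XZ]]; split.
- by move: X0; rewrite inE.
- by move=> a x y Xx Xy; have := XZ a x y; rewrite !inE; apply.
- by rewrite inE.
- by move=> a x y; rewrite !inE; exact: XZ.
Qed.

Lemma subspace0 X : linear_subspace X -> X 0.
Proof. by case/subspaceP. Qed.

Lemma subspaceZD X a x y : linear_subspace X -> X x -> X y -> X (a *: x + y).
Proof. by case/subspaceP=> _; exact. Qed.

Lemma subspaceZ X a x : linear_subspace X -> X x -> X (a *: x).
Proof.
by move=> sX Xx; rewrite -[_ *: _]addr0; apply: subspaceZD => //; exact: subspace0.
Qed.

Lemma subspaceD X x y : linear_subspace X -> X x -> X y -> X (x + y).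
Proof. by move=> sX Xx Xy; rewrite -[x]scale1r; exact: subspaceZD. Qed.

Lemma subspaceB X x y : linear_subspace X -> X x -> X y -> X (x - y).
Proof.
by move=> sX Xx Xy; rewrite addrC -scaleN1r; exact: subspaceZD.
Qed.

Lemma linear_on0 X f : linear_subspace X -> linear_on X f -> f 0 = 0.
Proof.
move=> /subspace0 X0 lf; have := lf (-1) 0 0 X0 X0.
by rewrite scaler0 addr0 scaleN1r addNr.
Qed.

Lemma linear_onZ X f a x : linear_subspace X -> linear_on X f -> X x ->
  f (a *: x) = a *: f x.
Proof.
move=> sX lf Xx; rewrite -[a *: x]addr0 lf//; last exact: subspace0.
by rewrite (linear_on0 sX lf) addr0.
Qed.

Lemma linear_onD X f x y : linear_on X f -> X x -> X y -> f (x + y) = f x + f y.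
Proof. by move=> lf Xx Xy; rewrite -{1}[x]scale1r lf// scale1r. Qed.

Lemma linear_onB X f x y : linear_on X f -> X x -> X y -> f (x - y) = f x - f y.
Proof. by move=> lf Xx Xy; rewrite addrC -scaleN1r lf// scaleN1r addrC. Qed.

End LinearOn.

(** The discriminant criterion, along the line [t = - s c^*] with [s] real.
    It gives both the Cauchy-Schwarz inequality and the rate at which a
    minimizing sequence satisfies the Euler equation. *)
Lemma quadratic_ge0 (R : realType) (A B : R) (c : R[i]) :
  0 <= B -> (forall t : R[i], 0 <= A + 2 * complex.Re (t * c) + rnorm t ^+ 2 * B) ->
  rnorm c ^+ 2 <= A * B.
Proof.
move=> B0 pos; set C := rnorm c ^+ 2.
have sqr_c : c * Num.conj c = C%:C%C by rewrite -normCK rnormE -rmorphXn.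
have {}pos s : 0 <= A - 2 * s * C + s ^+ 2 * C * B.
  have rs : rnorm (s%:C%C : R[i]) ^+ 2 = s ^+ 2.
    apply: complexI; rewrite !rmorphXn/= -rnormE.
    by rewrite normCK conj_Creal ?expr2// complex_real.
  have := pos (- (s%:C%C * Num.conj c)).
  rewrite rnormN rnormM rnorm_conj exprMn rs mulNr.
  have -> : s%:C%C * Num.conj c * c = (s * C)%:C%C.
    by rewrite -mulrA [Num.conj c * c]mulrC sqr_c -rmorphM.
  rewrite -rmorphN/= -/C => {}pos.
  by apply: (le_trans pos); rewrite le_eqVlt; apply/orP; left; apply/eqP; ring.
have C0 : 0 <= C by exact: sqr_ge0.
have A0 : 0 <= A by have := pos 0; rewrite !(mulr0, mul0r, expr0n)/= subr0 addr0.
have [C1|C1] := eqVneq C 0; first by rewrite C1 mulr_ge0.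
have {C0}C1 : 0 < C by rewrite lt_def C1.
have [B1|B1] := eqVneq B 0.
  (* the function is affine in s here, and already negative at this value *)
  have := pos ((A + 1) / (2 * C)); rewrite B1 mulr0 addr0.
  have -> : 2 * ((A + 1) / (2 * C)) * C = A + 1 by field; rewrite gt_eqF.
  by rewrite opprD addNKr lerNr oppr0 ler10.
have {B0}B1 : 0 < B by rewrite lt_def B1.
(* the minimum in s *)
have := pos B^-1.
have -> : A - 2 * B^-1 * C + B^-1 ^+ 2 * C * B = A - C / B.
  by field; rewrite gt_eqF.
by rewrite subr_ge0 ler_pdivrMr.
Qed.

(** * The Riesz representation theorem *)

Section InnerProduct.
Variables (R : realType) (H : completeNormedModType R[i]).
Variable ip : {dot H for (@Num.conj R[i])}.
Hypothesis ip_norm : induces_norm ip.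
Local Notation C := R[i].

Lemma ipC x y : ip x y = Num.conj (ip y x).
Proof. by rewrite (hermC ip) expr0 mul1r. Qed.

Lemma ipDl x y z : ip (x + y) z = ip x z + ip y z.
Proof. exact: linearDl. Qed.
Lemma ipBl x y z : ip (x - y) z = ip x z - ip y z.
Proof. exact: linearBl. Qed.
Lemma ipZl (a : C) x z : ip (a *: x) z = a * ip x z.
Proof. exact: linearZl_LR. Qed.
Lemma ip0l z : ip 0 z = 0.
Proof. exact: linear0l. Qed.
Lemma ipDr x y z : ip z (x + y) = ip z x + ip z y.
Proof. by rewrite ipC ipDl rmorphD/= -!ipC. Qed.
Lemma ipBr x y z : ip z (x - y) = ip z x - ip z y.
Proof. by rewrite ipC ipBl rmorphB/= -!ipC. Qed.
Lemma ipZr (a : C) x z : ip z (a *: x) = Num.conj a * ip z x.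
Proof. by rewrite ipC ipZl rmorphM/= -!ipC. Qed.
Lemma ipxx x : ip x x = (rnorm x ^+ 2)%:C%C.
Proof. by rewrite ip_norm rnormE rmorphXn. Qed.

Lemma ip_eq0 x : ip x x = 0 -> x = 0.
Proof.
rewrite ipxx => /complexI /eqP; rewrite sqrf_eq0 => /eqP x0.
by apply: rnorm_le0; rewrite x0.
Qed.

Lemma rnorm_sqrD x y :
  rnorm (x + y) ^+ 2 = rnorm x ^+ 2 + rnorm y ^+ 2 + 2 * complex.Re (ip x y).
Proof.
have -> : rnorm (x + y) ^+ 2 = complex.Re (ip (x + y) (x + y)) by rewrite ipxx.
by rewrite ipDl !ipDr !ReD !ipxx/= [ip y x]ipC Re_conj; ring.
Qed.

Lemma rnorm_parallelogram (x y : H) :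
  rnorm (x + y) ^+ 2 + rnorm (x - y) ^+ 2 = 2 * rnorm x ^+ 2 + 2 * rnorm y ^+ 2.
Proof.
rewrite !rnorm_sqrD rnormN -scaleN1r ipZr rmorphN rmorph1 mulN1r ReN; ring.
Qed.

Lemma cauchy_schwarz x y : rnorm (ip x y) <= rnorm x * rnorm y.
Proof.
rewrite -(@ler_pXn2r _ 2)// ?nnegrE ?mulr_ge0 ?rnorm_ge0//.
rewrite exprMn.
apply: quadratic_ge0 => [|t]; first exact: sqr_ge0.
have := sqr_ge0 (rnorm (x + Num.conj t *: y)).
rewrite rnorm_sqrD rnormZ ipZr rnorm_conj conjCK exprMn.
by rewrite -addrA [X in _ + X]addrC addrA.
Qed.

(** The Riesz representation theorem, for a functional given through a
    parametrization [a] of its domain of definition: [phi] descends along [a]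
    because it is dominated by it.  The representing vector is the limit of
    [a u] along a minimizing sequence of the energy [|a u|^2 - 2 Re (phi u)]. *)
Lemma riesz_param (X U : set H) (a : H -> H) (phi : H -> C^o) (M : R) :
  closed X -> linear_subspace U -> linear_on U a -> linear_on U phi ->
  (forall u, U u -> X (a u)) ->
  0 <= M -> (forall u, U u -> rnorm (phi u) <= M * rnorm (a u)) ->
  exists p, [/\ X p, forall u, U u -> phi u = ip (a u) p & rnorm p <= M].
Proof.
move=> cX sU la lphi aX M0 bphi.
pose J u := rnorm (a u) ^+ 2 - 2 * complex.Re (phi u).
pose E := [set J u | u in U].
have U0 : U 0 by exact: subspace0.
have Elb : has_lbound E.
  exists (- M ^+ 2) => _ [u Uu <-]; rewrite /J.
  have := le_trans (Re_le_rnorm _) (bphi u Uu).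
  have := sqr_ge0 (M - rnorm (a u)).
  by nra.
have Einf : has_inf E by split=> //; exists (J 0); exists 0.
have mJ u : U u -> inf E <= J u by move=> Uu; apply: ge_inf => //; exists u.
have Jt u v t : U u -> U v -> J (t *: v + u) =
    J u + 2 * complex.Re (t * (ip (a v) (a u) - phi v)) + rnorm t ^+ 2 * rnorm (a v) ^+ 2.
  move=> Uu Uv; rewrite /J la// lphi// rnorm_sqrD rnormZ ipZl exprMn mulrBr.
  rewrite !ReD ReN -[t *: phi v]/(t * phi v); ring.
pose d (k : nat) : R := k.+1%:R^-1.
have d0 k : 0 < d k by rewrite invr_gt0.
have /choice[u uP] : forall k, exists u, U u /\ J u < inf E + d k ^+ 2 / 4.
  move=> k; have [|_ [v Uv <-] Jv] := @inf_adherent _ E (d k ^+ 2 / 4) _ Einf.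
    by rewrite divr_gt0// exprn_gt0.
  by exists v.
(* the energy at the midpoint turns the parallelogram law into a Cauchy bound *)
have dist v w : U v -> U w ->
    rnorm (a v - a w) ^+ 2 <= 2 * (J v - inf E) + 2 * (J w - inf E).
  move=> Uv Uw; have U2 : U (2^-1 *: (v + w)).
    by apply: subspaceZ => //; exact: subspaceD.
  have := mJ _ U2; rewrite /J.
  have Uvw : U (v + w) by exact: subspaceD.
  rewrite (linear_onZ _ sU la)// (linear_onZ _ sU lphi)//.
  rewrite (linear_onD la)// (linear_onD lphi)// rnormZ exprMn.
  have -> : (2^-1 : C) = (2^-1)%:C%C by rewrite fmorphV/= rmorph_nat.
  rewrite rnorm_real ?invr_ge0// -[_ *: (_ + _)]/(_ * _) ReZ ReD.
  have := rnorm_parallelogram (a v) (a w).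
  by lra.
have [p Xp up] : exists2 p, X p & forall k, rnorm (a (u k) - p) <= d k.
  apply: complete_lim => //.
  - by move=> k; apply: aX; exact: (uP k).1.
  - move=> k l kl; rewrite -(@ler_pXn2r _ 2) ?nnegrE ?rnorm_ge0//; last exact: ltW.
    have [Uk Jk] := uP k; have [Ul Jl] := uP l.
    apply: (le_trans (dist _ _ Uk Ul)).
    have : d l ^+ 2 <= d k ^+ 2.
      by rewrite ler_pXn2r ?nnegrE ?(ltW (d0 _))// /d lef_pV2 ?posrE// ler_nat ltnS.
    by lra.
  - by move=> e e0; exact: harmonic_lt.
have repr v : U v -> phi v = ip (a v) p.
  move=> Uv; apply/esym/subr0_eq/rnorm_le0.
  apply: (@le_of_harmonic _ _ _ (2 * rnorm (a v))) => k; rewrite add0r.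
  have [Uk Jk] := uP k.
  have : rnorm (ip (a v) (a (u k)) - phi v) <= d k * rnorm (a v).
    rewrite -(@ler_pXn2r _ 2) ?nnegrE ?mulr_ge0 ?rnorm_ge0 ?(ltW (d0 _))// exprMn.
    apply: (@le_trans _ _ ((J (u k) - inf E) * rnorm (a v) ^+ 2)).
      apply: quadratic_ge0 => [|t]; first exact: sqr_ge0.
      have := mJ _ (subspaceZD t sU Uv Uk); rewrite Jt//.
      by lra.
    by rewrite ler_wpM2r ?sqr_ge0//; have := sqr_ge0 (d k); lra.
  have : rnorm (ip (a v) (p - a (u k))) <= d k * rnorm (a v).
    rewrite (le_trans (cauchy_schwarz _ _))// mulrC ler_wpM2r ?rnorm_ge0//.
    by rewrite rnormBC.
  have -> : ip (a v) p - phi v =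
      ip (a v) (p - a (u k)) + (ip (a v) (a (u k)) - phi v).
    by rewrite ipBr addrA subrK.
  move=> h1 h2; rewrite (le_trans (rnormD _ _))//.
  by rewrite -[_ / _]/(_ * d k); lra.
exists p; split=> //.
have [->|/rnorm_gt0 p0] := eqVneq p 0; first by rewrite rnorm0.
rewrite -(ler_pM2r p0) -expr2.
apply: (@le_of_harmonic _ _ _ (rnorm p + M)) => k.
have [Uk Jk] := uP k.
have : rnorm p ^+ 2 <= rnorm (ip (p - a (u k)) p) + rnorm (ip (a (u k)) p).
  apply: le_trans (rnormD _ _); rewrite -ipDl subrK ipxx.
  by rewrite rnorm_real// sqr_ge0.
have := cauchy_schwarz (p - a (u k)) p.
have := bphi _ Uk; rewrite -repr//.
have pu := up k; have : rnorm (a (u k)) <= rnorm p + d k.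
  rewrite -[a _](subrK p) addrC (le_trans (rnormD _ _))// lerD2l//.
rewrite -[_ / _]/(_ * d k).
rewrite rnormBC in pu.
have := rnorm_ge0 p.
by nra.
Qed.
End InnerProduct.

(** * Uniform boundedness *)

(** The uniform boundedness principle on a closed subspace.  If it failed, a
    vector on which some [psi i] is large could be found in every ball, and the
    same [psi i] would be large on a smaller ball around it; the centres of
    such nested balls converge to a vector at which the family is unbounded. *)
Lemma uniform_boundedness (R : realType) (H : completeNormedModType R[i])
    (W : normedModType R[i]) (X : set H) (I : Type) (psi : I -> H -> W) :
  closed X -> linear_subspace X -> (forall i, linear_on X (psi i)) ->
  (forall i, exists M, forall x, X x -> rnorm (psi i x) <= M * rnorm x) ->
  (forall x, X x -> exists M, forall i, rnorm (psi i x) <= M) ->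
  exists2 M, 0 <= M & forall i x, X x -> rnorm (psi i x) <= M * rnorm x.
Proof.
move=> cX sX lpsi bpsi ppsi; apply: contrapT => unb.
have {}unb N : 0 <= N -> exists i v, X v /\ N * rnorm v < rnorm (psi i v).
  move=> N0; apply: contrapT => nex; apply: unb; exists N => // i v Xv.
  by rewrite leNgt; apply/negP => lt; apply: nex; exists i, v.
pose in_ball (p : H * R) y := rnorm (p.1 - y) <= p.2.
pose ok (p : H * R) := X p.1 /\ 0 < p.2.
pose smaller (n : nat) (p q : H * R) := [/\ ok q, q.2 <= n.+1%:R^-1,
  forall y, in_ball q y -> in_ball p y &
  forall y, X y -> in_ball q y -> exists i, n%:R <= rnorm (psi i y)].
have step (np : nat * (H * R)) : exists q, ok np.2 -> smaller np.1 np.2 q.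
  case: np => n [x r] /=; have [[/= Xx r0]|nok] := pselect (ok (x, r)); last first.
    by exists (x, r) => /nok.
  (* N makes psi i at least n + 1 on a multiple of v of norm r / 2 *)
  have N0 : 0 <= 2 * (n.+1%:R) / r by rewrite divr_ge0 ?mulr_ge0// ltW.
  have [i [v [Xv big]]] := unb _ N0.
  have [M0 bM0] := bpsi i.
  pose M := `|M0| + 1.
  have M_gt0 : 0 < M by rewrite ltr_wpDl.
  have bM y : X y -> rnorm (psi i y) <= M * rnorm y.
    move=> /bM0/le_trans; apply; rewrite ler_wpM2r ?rnorm_ge0// /M.
    by rewrite (le_trans (ler_norm _))// lerDl.
  have v0 : 0 < rnorm v.
    apply: rnorm_gt0; apply/eqP => v0; move: big.
    by rewrite v0 (linear_on0 sX (lpsi i)) !rnorm0 mulr0 ltxx.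
  pose t := r / 2 / rnorm v.
  have t0 : 0 <= t by rewrite !divr_ge0 ?rnorm_ge0// ltW.
  pose w := t%:C%C *: v.
  have Xw : X w by exact: subspaceZ.
  have nw : rnorm w = r / 2 by rewrite rnormZ rnorm_real// divfK// gt_eqF.
  have bigw : n.+1%:R <= rnorm (psi i w).
    rewrite (linear_onZ _ sX (lpsi i))// rnormZ rnorm_real//.
    apply: (@le_trans _ _ (t * (2 * n.+1%:R / r * rnorm v))); last first.
      by rewrite ler_wpM2l// ltW.
    rewrite /t le_eqVlt; apply/orP; left; apply/eqP; field.
    by rewrite !gt_eqF.
  (* one of x + w, x - w will do, their images being 2 psi i w apart *)
  have [x' [Xx' x'x bigx]] : exists x', [/\ X x', rnorm (x - x') = r / 2 &
      n.+1%:R <= rnorm (psi i x')].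
    have [le1|lt1] := leP n.+1%:R (rnorm (psi i (x + w))).
      exists (x + w); split=> //; first exact: subspaceD.
      by rewrite opprD addNKr rnormN.
    have [le2|lt2] := leP n.+1%:R (rnorm (psi i (x - w))).
      exists (x - w); split=> //; first exact: subspaceB.
      by rewrite opprB addrC subrK.
    have := rnormB (psi i (x + w)) (psi i (x - w)).
    rewrite -(linear_onB (lpsi i)); [|exact: subspaceD|exact: subspaceB].
    have -> : x + w - (x - w) = 2 *: w.
      by rewrite opprB addrC addrA subrK -mulr2n scaler_nat.
    rewrite (linear_onZ _ sX (lpsi i))// rnormZ.
    have -> : rnorm (2 : R[i]) = 2.
      by rewrite -[2]/(2%:R) -(rmorph_nat (real_complex R)) rnorm_real.
    by lra.
  pose r' := Num.min (r / 2) (Num.min M^-1 n.+1%:R^-1).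
  have r'1 : r' <= r / 2 by rewrite ge_min lexx.
  have r'2 : r' <= M^-1 by rewrite !ge_min lexx orbT.
  have r'3 : r' <= n.+1%:R^-1 by rewrite !ge_min lexx !orbT.
  exists (x', r') => _; split => //=.
  - by split=> //=; rewrite !lt_min !invr_gt0 M_gt0 ltr0n divr_gt0.
  - move=> y; rewrite /in_ball/= => x'y; rewrite -(subrKA x').
    by rewrite (le_trans (rnormD _ _))//; lra.
  - move=> y Xy; rewrite /in_ball/= => x'y; exists i.
    have := bM (x' - y) (subspaceB sX Xx' Xy).
    rewrite (linear_onB (lpsi i))// => close.
    have {}close : rnorm (psi i x' - psi i y) <= 1.
      by apply: (le_trans close); rewrite -ler_pdivlMl// mulr1 (le_trans x'y).
    have := rnormD (psi i x' - psi i y) (psi i y); rewrite subrK.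
    by move: bigx; rewrite -natr1 => bigx h; lra.
have [g gP] := choice step.
pose s := fix s (n : nat) : H * R := if n is k.+1 then g (k, s k) else ((0 : H), 1 : R).
have oks n : ok (s n).
  elim: n => [|n IH]; first by split=> //=; exact: subspace0.
  by have [] := gP (n, s n) IH.
have sS n : smaller n (s n) (s n.+1) by exact: (gP (n, s n) (oks n)).
have nested k l y : (k <= l)%N -> in_ball (s l) y -> in_ball (s k) y.
  move=> /subnK <-; elim: (l - k)%N => // m IH; rewrite addSn.
  by case: (sS (m + k)%N) => _ _ + _ => /[apply].
have [y Xy ys] : exists2 y, X y & forall k, rnorm ((s k).1 - y) <= (s k).2.
  apply: complete_lim => //.
  - by move=> k; exact: (oks k).1.
  - move=> k l kl; apply: (nested _ _ _ kl); rewrite /in_ball subrr rnorm0.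
    by rewrite ltW//; exact: (oks l).2.
  - move=> d /harmonic_lt[k kd]; exists k.+1.
    by case: (sS k) => _ + _ _ => /le_lt_trans; apply.
have [M yM] := ppsi y Xy.
pose n := Num.truncn M.
case: (sS n.+1) => _ _ _ /(_ y Xy (ys _))[j].
by have := yM j; have := truncnS_gt M; rewrite -/n; lra.
Qed.

(** * Linear maps on finite-dimensional subspaces *)

Section FiniteDimension.
Variables (R : realType) (H : completeNormedModType R[i]).
Variable ip : {dot H for (@Num.conj R[i])}.
Hypothesis ip_norm : induces_norm ip.

Definition span_of n (e : 'I_n -> H) : set H :=
  [set \sum_(i < n) c i *: e i | c in [set: 'I_n -> R[i]]].

Lemma span_of_subspace n (e : 'I_n -> H) : linear_subspace (span_of e).
Proof.
apply/subspaceP; split.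
  by exists (fun=> 0) => //; rewrite big1// => i _; rewrite scale0r.
move=> a _ _ [c _ <-] [d _ <-]; exists (fun i => a * c i + d i) => //.
by rewrite scaler_sumr -big_split; apply: eq_bigr => i _; rewrite scalerDl scalerA.
Qed.

Lemma subspace_sum (X : set H) (I : eqType) (s : seq I) (f : I -> H) :
  linear_subspace X -> (forall i, i \in s -> X (f i)) -> X (\sum_(i <- s) f i).
Proof.
move=> sX Xf; rewrite big_seq; elim/big_ind: _ => //; first exact: subspace0.
by move=> x y; exact: subspaceD.
Qed.

Lemma linear_on_sum (X : set H) (I : eqType) (s : seq I) (f : I -> H) (L : H -> H) :
  linear_subspace X -> linear_on X L -> (forall i, i \in s -> X (f i)) ->
  L (\sum_(i <- s) f i) = \sum_(i <- s) L (f i).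
Proof.
move=> sX lL; elim: s => [|i s IH] Xf; first by rewrite !big_nil (linear_on0 sX lL).
have Xs j : j \in s -> X (f j) by move=> js; apply: Xf; rewrite inE js orbT.
rewrite !big_cons (linear_onD lL) ?IH//; first by apply: Xf; exact: mem_head.
exact: subspace_sum.
Qed.

(** Gram-Schmidt, in the form of the Fourier expansion that it yields.  The
    expansion at level [n] already makes the remainder [p] of the new vector
    orthogonal to the old span, so that orthonormality of the family never has
    to be carried along. *)
Lemma fourier_expansion n (e : 'I_n -> H) : exists s : seq H,
  (forall v, v \in s -> span_of e v) /\
  forall x, span_of e x -> x = \sum_(v <- s) ip x v *: v.
Proof.
elim: n e => [|n IH] e.
  exists [::]; split=> // _ [c _ <-].
  by rewrite big_nil big_ord0.
pose e' i := e (widen_ord (leqnSn n) i); pose a := e ord_max.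
have [s [s_span expand]] := IH e'.
have spanE x : span_of e x <-> exists c y, span_of e' y /\ x = c *: a + y.
  split=> [[c _ <-]|[c [_ [[d _ <-] ->]]]].
    exists (c ord_max), (\sum_(i < n) c (widen_ord (leqnSn n) i) *: e' i).
    split; last by rewrite big_ord_recr addrC.
    by exists (fun i => c (widen_ord (leqnSn n) i)).
  exists (fun i => if unlift ord_max i is Some j then d j else c) => //.
  rewrite big_ord_recr unlift_none addrC; congr (_ + _); apply: eq_bigr => i _.
  have -> : widen_ord (leqnSn n) i = lift ord_max i.
    by apply: val_inj; rewrite /= /bump leqNgt ltn_ord.
  by rewrite liftK; congr (_ *: e _); apply: val_inj; rewrite /= /bump leqNgt ltn_ord.
have sub y : span_of e' y -> span_of e y.
  by move=> y'; apply/spanE; exists 0, y; rewrite scale0r add0r.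
have sE := span_of_subspace e; have sE' := span_of_subspace e'.
pose q := \sum_(v <- s) ip a v *: v; pose p := a - q.
have Eq : span_of e' q.
  by apply: subspace_sum => // v vs; apply: subspaceZ => //; exact: s_span.
have Ep : span_of e p.
  apply: subspaceB => //; last exact: sub.
  by apply/spanE; exists 1, 0; split; [exact: subspace0|rewrite scale1r addr0].
have ip_sum (t : seq H) (c : H -> R[i]) z :
    ip (\sum_(v <- t) c v *: v) z = \sum_(v <- t) c v * ip v z.
  by elim: t => [|v t IHt]; rewrite ?big_nil ?ip0l// !big_cons ipDl ipZl IHt.
have orth y : span_of e' y -> ip p y = 0.
  move=> y'; rewrite ipBl ip_sum [ip a y]ipC {1}(expand y y') ip_sum rmorph_sum.
  rewrite -sumrB big1_seq// => v _.
  by rewrite rmorphM/= -!ipC mulrC subrr.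
(* if p = 0, then u = 0, which contributes nothing to the expansion *)
pose u := ((rnorm p)^-1)%:C%C *: p.
have Eu : span_of e u by exact: subspaceZ.
exists (u :: s); split=> [v|x /spanE[c [y [y' ->]]]].
  by rewrite inE => /orP[/eqP->//|/s_span]; exact: sub.
have -> : c *: a + y = c *: p + (c *: q + y).
  by rewrite addrA -scalerDr subrK.
have := subspaceZD c sE' Eq y'; move: (c *: q + y) => {}y {}y'.
rewrite big_cons; congr (_ + _).
  rewrite ipDl ipZl /u !ipZr [ip y p]ipC (orth y y') rmorph0 mulr0 addr0.
  rewrite ipxx// scalerA; have [->|p0] := eqVneq p 0; first by rewrite !scaler0.
  congr (_ *: _).
  rewrite conj_Creal ?complex_real// -!mulrA mulrCA -!rmorphM/= mulrC.
  rewrite -mulrA -rmorphM/=.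
  have -> : rnorm p ^+ 2 / rnorm p / rnorm p = 1.
    by field; rewrite gt_eqF// rnorm_gt0.
  by rewrite mulr1.
rewrite [LHS]expand//; apply: eq_big_seq => v vs.
by rewrite ipDl ipZl (orth v (s_span v vs)) mulr0 add0r.
Qed.

Lemma finite_dimensional_bounded (X : set H) (L : H -> H) :
  finite_dimensional X -> linear_on X L ->
  exists2 M, 0 <= M & forall x, X x -> rnorm (L x) <= M * rnorm x.
Proof.
move=> [n [e ->]] lL; have sE := span_of_subspace e.
have [s [s_span expand]] := fourier_expansion e.
exists (\sum_(v <- s) rnorm v * rnorm (L v)).
  by apply: sumr_ge0 => v _; rewrite mulr_ge0 ?rnorm_ge0.
move=> x Ex; rewrite {1}(expand x Ex) (linear_on_sum sE lL); last first.
  by move=> v vs; apply: subspaceZ => //; exact: s_span.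
have norm_sum (t : seq H) (f : H -> H) :
    rnorm (\sum_(v <- t) f v) <= \sum_(v <- t) rnorm (f v).
  elim: t => [|v t IHt]; first by rewrite !big_nil rnorm0.
  by rewrite !big_cons (le_trans (rnormD _ _))// lerD2l.
rewrite (le_trans (norm_sum _ _))// mulr_suml.
rewrite big_seq [leRHS]big_seq; apply: ler_sum => v vs.
rewrite (linear_onZ _ sE lL (s_span v vs)) rnormZ.
rewrite mulrAC ler_wpM2r ?rnorm_ge0// mulrC.
exact: cauchy_schwarz.
Qed.
End FiniteDimension.

(** * Resolvents of a self-adjoint operator *)

Section SelfAdjoint.
Variables (R : realType) (H : completeNormedModType R[i]).
Variable ip : {dot H for (@Num.conj R[i])}.
Hypothesis ip_norm : induces_norm ip.
Variable T : operator H.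
Hypothesis T_sa : self_adjoint ip T.
Local Notation D := (odom T).
Local Notation C := R[i].

Let sD : linear_subspace D. Proof. by case: T_sa => -[]. Qed.
Let lT : linear_on D T. Proof. by case: T_sa => -[]. Qed.

Lemma dense_ortho v : (forall x, D x -> ip x v = 0) -> v = 0.
Proof.
move=> ov; apply: contrapT => /eqP/rnorm_gt0 v0.
have dD : dense D by case: T_sa.
have v0C : 0 < (rnorm v)%:C%C :> C by rewrite ltr0c.
have [||x [/= + Dx]] := dD (ball v (rnorm v)%:C%C).
- by exists v; exact: ballxx.
- exact: ball_open.
rewrite -ball_normE /= rnormE ltcR => xv.
have : rnorm v ^+ 2 <= rnorm (v - x) * rnorm v.
  rewrite (le_trans _ (cauchy_schwarz ip_norm _ _))// ipBl (ov x)// subr0.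
  by rewrite ipxx// rnorm_real// sqr_ge0.
by rewrite expr2 ler_pM2r// leNgt xv.
Qed.

Lemma sa_sym x y : D x -> D y -> ip (T x) y = ip x (T y).
Proof.
case: T_sa => _ _ [DT TT] Dx Dy.
have := Dy; rewrite DT => -[_ R0].
have [] := xgetPex 0 R0; rewrite -[xget 0 _]/(adjoint ip setT T y) -TT// => _.
exact.
Qed.

(** The half of self-adjointness that goes beyond symmetry: it is how vectors
    characterized only by inner products are placed in the domain of [T]. *)
Lemma sa_max y w : (forall x, D x -> ip (T x) y = ip x w) -> D y /\ T y = w.
Proof.
move=> yw; have Dy : D y.
  by case: T_sa => _ _ [-> _]; split=> //; exists w.
split=> //; apply/subr0_eq/dense_ortho => x Dx.
by rewrite ipBr -sa_sym// yw// subrr.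
Qed.

Lemma linear_on_shift (l : C) : linear_on D (fun x => l *: x - T x).
Proof.
move=> a x y Dx Dy; rewrite lT// scalerDr scalerBr !scalerA mulrC opprD.
by rewrite !addrA; congr (_ - _); rewrite addrAC.
Qed.

(** The quadratic form of [T] being real, the imaginary part of [l] alone
    controls the form of [l - T]. *)
Lemma shift_form_ge (l : C) x : D x ->
  `|complex.Im l| * rnorm x ^+ 2 <= rnorm (ip x (l *: x - T x)).
Proof.
move=> Dx; apply: le_trans (Im_le_rnorm _).
rewrite ipBr ipZr ipxx// [_ * _%:C%C]mulrC ImD ImN ImZ Im_conj.
have -> : complex.Im (ip x (T x)) = 0.
  have : complex.Im (ip x (T x)) = - complex.Im (ip x (T x)).
    by rewrite -Im_conj -ipC sa_sym.
  by lra.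
by rewrite oppr0 addr0 normrM normrN [`|_ ^+ 2|]ger0_norm ?sqr_ge0// mulrC.
Qed.

Lemma shift_norm_ge (l : C) x : D x ->
  `|complex.Im l| * rnorm x <= rnorm (l *: x - T x).
Proof.
move=> Dx; have [->|/rnorm_gt0 x0] := eqVneq x 0.
  by rewrite rnorm0 mulr0 rnorm_ge0.
rewrite -(ler_pM2l x0); apply: le_trans (cauchy_schwarz ip_norm _ _).
by apply: le_trans (shift_form_ge _ Dx); rewrite mulrCA -expr2.
Qed.

Lemma shift_inj (l : C) x y : complex.Im l != 0 -> D x -> D y ->
  l *: x - T x = l *: y - T y -> x = y.
Proof.
move=> l0 Dx Dy xy; apply/subr0_eq/rnorm_le0.
have := shift_norm_ge l (subspaceB sD Dx Dy).
rewrite (linear_onB (linear_on_shift l))// xy subrr rnorm0.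
by rewrite pmulr_rle0// normr_gt0.
Qed.

(** Surjectivity of [l - T] is the Riesz theorem for the functional
    [(l^* - T) u |-> (u, y)]: a vector representing it lies in the domain of
    the adjoint of [T], hence in that of [T]. *)
Lemma shift_surj (l : C) y : complex.Im l != 0 ->
  exists2 x, D x & l *: x - T x = y.
Proof.
move=> l0.
have nl : 0 < `|complex.Im l| by rewrite normr_gt0.
have [||||p [_ rep _]] := @riesz_param R H ip ip_norm setT D
  (fun u => Num.conj l *: u - T u)
  (fun u => ip u y) (rnorm y / `|complex.Im l|) (@closedT H) sD
  (linear_on_shift (Num.conj l)).
- by move=> a u v _ _; rewrite ipDl ipZl.
- by [].
- by rewrite divr_ge0 ?rnorm_ge0.
- move=> u Du; rewrite (le_trans (cauchy_schwarz ip_norm _ _))//.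
  rewrite mulrC -mulrA ler_wpM2l ?rnorm_ge0// ler_pdivlMl//.
  by have := shift_norm_ge (Num.conj l) Du; rewrite Im_conj normrN.
have [|Dp Tp] := @sa_max p (l *: p - y); last by exists p; rewrite // Tp subKr.
move=> u Du; have := rep u Du; rewrite ipBl ipZl ipBr ipZr => ->.
by rewrite subKr.
Qed.

End SelfAdjoint.

(** * Compression of the resolvent to a closed subspace *)

Section Compression.
Variables (R : realType) (H : completeNormedModType R[i]).
Variable ip : {dot H for (@Num.conj R[i])}.
Hypothesis ip_norm : induces_norm ip.
Variable T : operator H.
Hypothesis T_sa : self_adjoint ip T.
Variable H0 : set H.
Hypothesis sH0 : linear_subspace H0.
Hypothesis cH0 : closed H0.
Local Notation D := (odom T).
Local Notation C := R[i].
Local Notation P := (orthoproj ip H0).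

Let sD : linear_subspace D. Proof. by case: T_sa => -[]. Qed.
Let lT : linear_on D T. Proof. by case: T_sa => -[]. Qed.

(** The projection of [x] is the vector of [H0] that represents [u |-> (u, x)]
    on [H0]. *)
Lemma proj_spec x : H0 (P x) /\ forall h, H0 h -> ip (x - P x) h = 0.
Proof.
rewrite /=.
apply: (xgetPex 0 (P := [set p | H0 p /\ forall h, H0 h -> ip (x - p) h = 0])).
have [|||||p [Hp rep _]] := @riesz_param R H ip ip_norm H0 H0 id
  (fun u => ip u x) (rnorm x) cH0 sH0.
- by [].
- by move=> a u v _ _; rewrite ipDl ipZl.
- by [].
- exact: rnorm_ge0.
- by move=> u _; rewrite mulrC cauchy_schwarz.
exists p; split=> // h Hh; rewrite ipC.
by rewrite ipBr rep// subrr rmorph0.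
Qed.

Lemma projH0 x : H0 (P x). Proof. exact: (proj_spec x).1. Qed.

Lemma proj_ip x h : H0 h -> ip (P x) h = ip x h.
Proof. by move=> /(proj_spec x).2; rewrite ipBl => /subr0_eq. Qed.

Lemma proj_eq x p : H0 p -> (forall h, H0 h -> ip p h = ip x h) -> P x = p.
Proof.
move=> Hp px; apply/subr0_eq/(ip_eq0 ip_norm).
have Hd : H0 (P x - p) by exact: (subspaceB sH0 (projH0 x)).
by rewrite {1}ipBl (proj_ip x Hd) (px _ Hd) subrr.
Qed.

Lemma proj_id x : H0 x -> P x = x.
Proof. by move=> Hx; exact: proj_eq. Qed.

Lemma projB x y : P (x - y) = P x - P y.
Proof.
apply: proj_eq => [|h Hh]; first exact: (subspaceB sH0 (projH0 x) (projH0 y)).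
by rewrite !ipBl !proj_ip.
Qed.

Lemma projZD a x y : P (a *: x + y) = a *: P x + P y.
Proof.
apply: proj_eq => [|h Hh]; first exact: (subspaceZD _ sH0 (projH0 x) (projH0 y)).
by rewrite !(ipDl, ipZl) !proj_ip.
Qed.

Lemma projZ a x : P (a *: x) = a *: P x.
Proof.
apply: proj_eq => [|h Hh]; first exact: (subspaceZ _ sH0 (projH0 x)).
by rewrite !ipZl !proj_ip.
Qed.

Lemma proj_norm x : rnorm (P x) <= rnorm x.
Proof.
have [->|/rnorm_gt0 x0] := eqVneq (P x) 0; first by rewrite rnorm0 rnorm_ge0.
rewrite -(ler_pM2r x0); apply: le_trans (cauchy_schwarz ip_norm _ _).
by rewrite -(proj_ip x (projH0 x)) ipxx// rnorm_real ?sqr_ge0// expr2.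
Qed.

(** The estimate that both cases of the theorem provide: the resolvent of [T]
    is bounded below on [H0]. *)
Definition shift_le_on (l : C) : Prop :=
  exists2 c, 0 <= c & forall x, D x -> H0 (l *: x - T x) ->
    rnorm (l *: x - T x) <= c * rnorm x.

(** The solutions [x] of [(l - T) x] in [H0] form a finite-dimensional space,
    spanned by the images of a spanning family of [H0] under the resolvent, and
    [l - T] is bounded on it. *)
Lemma shift_le_on_finite_dim (l : C) : complex.Im l != 0 ->
  finite_dimensional H0 -> shift_le_on l.
Proof.
move=> l0 [n [e eH0]].
have He i : H0 (e i).
  rewrite eH0; exists (fun j => (j == i)%:R) => //.
  rewrite (bigD1 i)//= eqxx scale1r big1 ?addr0// => j /negbTE ->.
  by rewrite scale0r.
have /choice[x xP] : forall i, exists x, D x /\ l *: x - T x = e i.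
  by move=> i; have [x ? ?] := shift_surj ip_norm T_sa (e i) l0; exists x.
have lS := linear_on_shift T_sa l.
have Xfin : finite_dimensional (span_of x) by exists n, x.
have XD : span_of x `<=` D.
  move=> _ [c _ <-]; apply: subspace_sum => // i _.
  by apply: subspaceZ => //; exact: (xP i).1.
have [c c0 bc] := finite_dimensional_bounded ip_norm Xfin
  (fun a y z Xy Xz => lS a y z (XD _ Xy) (XD _ Xz)).
exists c => // y Dy; rewrite {1}eH0 => -[d _ dy]; apply: bc.
exists d => //; apply: (shift_inj ip_norm T_sa l0) => //.
  by apply: XD; exists d.
rewrite -dy (linear_on_sum sD lS).
  by apply: eq_bigr => i _; rewrite (linear_onZ _ sD lS) ?(xP i).2//; exact: (xP i).1.
by move=> i _; apply: subspaceZ => //; exact: (xP i).1.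
Qed.

(** A Hellinger-Toeplitz theorem: for [u] in the domain of [T] the functionals
    [h |-> (T h, u) / |u|] are bounded because [T] is symmetric, and pointwise
    bounded by [|T h|]; the domain being dense, their common bound is one for
    [T] on [H0]. *)
Lemma bounded_on_subdomain : H0 `<=` D ->
  exists2 M, 0 <= M & forall h, H0 h -> rnorm (T h) <= M * rnorm h.
Proof.
move=> H0D.
pose psi (u : {u | D u}) (h : H) : C^o :=
  ((rnorm (sval u))^-1)%:C%C * ip (T h) (sval u).
have inv_ge0 (u : H) : 0 <= (rnorm u)^-1 by rewrite invr_ge0 rnorm_ge0.
have [|||M M0 bM] := @uniform_boundedness R H C^o H0 _ psi cH0 sH0.
- move=> [u Du] a x y Hx Hy; rewrite /psi/= lT; [|exact: H0D|exact: H0D].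
  by rewrite ipDl ipZl mulrDr mulrCA.
- move=> [u Du]; exists ((rnorm u)^-1 * rnorm (T u)) => x Hx.
  rewrite /psi/= rnormM rnorm_real// -mulrA ler_wpM2l//.
  rewrite (sa_sym T_sa)//; last exact: H0D.
  by rewrite mulrC cauchy_schwarz.
- move=> x Hx; exists (rnorm (T x)) => -[u Du]; rewrite /psi/= rnormM rnorm_real//.
  have [->|u0] := eqVneq u 0; first by rewrite rnorm0 invr0 mul0r rnorm_ge0.
  rewrite mulrC ler_pdivrMr ?rnorm_gt0//.
  exact: cauchy_schwarz.
exists M => // h Hh.
(* the vector representing u |-> (u, T h) on the dense domain is T h itself *)
have [|||||p [_ rep pM]] := @riesz_param R H ip ip_norm setT D id
    (fun u => ip u (T h)) (M * rnorm h) (@closedT H) sD.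
- by [].
- by move=> a u v _ _; rewrite ipDl ipZl.
- by [].
- by rewrite mulr_ge0 ?rnorm_ge0.
- move=> u Du; have [->|u0] := eqVneq u 0; first by rewrite ip0l !rnorm0 mulr0.
  have := bM (exist _ u Du) h Hh.
  rewrite /psi/= rnormM rnorm_real// mulrC ler_pdivrMr ?rnorm_gt0//.
  by rewrite [ip u _]ipC rnorm_conj.
suff -> : T h = p by [].
apply/subr0_eq/(dense_ortho ip_norm T_sa) => u Du.
by rewrite ipBr rep// subrr.
Qed.

(** With [h = (l - T) x] one has [|h|^2 = (x, (l^* - T) h)], and [l^* - T] is
    bounded on [H0]. *)
Lemma shift_le_on_subdomain (l : C) : H0 `<=` D -> shift_le_on l.
Proof.
move=> H0D; have [M M0 bM] := bounded_on_subdomain H0D.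
exists (rnorm l + M) => [|x Dx]; first by rewrite addr_ge0 ?rnorm_ge0.
move hE : (l *: x - T x) => h Hh.
have Dh : D h by exact: H0D.
have [->|/rnorm_gt0 h0] := eqVneq h 0.
  by rewrite rnorm0 mulr_ge0 ?addr_ge0 ?rnorm_ge0.
have form : (rnorm h ^+ 2)%:C%C = ip x (Num.conj l *: h - T h).
  by rewrite -(ipxx ip_norm) -{1}hE ipBl ipZl (sa_sym T_sa)// ipBr ipZr conjCK.
have := cauchy_schwarz ip_norm x (Num.conj l *: h - T h).
rewrite -form rnorm_real ?sqr_ge0// => h2.
rewrite -(ler_pM2r h0) -expr2 (le_trans h2)// mulrAC mulrC.
rewrite ler_wpM2r ?rnorm_ge0// (le_trans (rnormB _ _))// mulrDl rnormZ rnorm_conj.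
by rewrite lerD2l bM.
Qed.

(** The compression [P (l - T)^-1] of the resolvent to [H0] is coercive, hence
    onto by the Lax-Milgram argument: a preimage of [g] represents the
    functional [P u |-> ((l^* - T) u, g)] on the range of its adjoint. *)
Lemma compressed_resolvent_surj (l : C) :
  complex.Im l != 0 -> shift_le_on (Num.conj l) ->
  exists2 K, 0 <= K & forall g, H0 g -> exists x,
    [/\ D x, H0 (l *: x - T x), P x = g & rnorm (l *: x - T x) <= K * rnorm g].
Proof.
move=> l0 [c c0 bc].
have nl : 0 < `|complex.Im l| by rewrite normr_gt0.
have K0 : 0 <= c ^+ 2 / `|complex.Im l| by rewrite divr_ge0 ?sqr_ge0.
exists (c ^+ 2 / `|complex.Im l|) => // g Hg.
pose L u := Num.conj l *: u - T u.
have lL : linear_on D L := linear_on_shift T_sa _.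
pose U := [set u | D u /\ H0 (L u)].
have sU : linear_subspace U.
  apply/subspaceP; split.
    by split; [exact: subspace0|rewrite (linear_on0 sD lL); exact: subspace0].
  move=> a u v [Du Hu] [Dv Hv]; split; first exact: subspaceZD.
  by rewrite lL//; exact: subspaceZD.
have coercive u : U u -> rnorm (L u) <= c ^+ 2 / `|complex.Im l| * rnorm (P u).
  move=> [Du Hu]; have [->|/rnorm_gt0 Lu0] := eqVneq (L u) 0.
    by rewrite rnorm0 mulr_ge0 ?rnorm_ge0.
  have := shift_form_ge ip_norm T_sa (Num.conj l) Du.
  rewrite -/(L u) Im_conj normrN -(proj_ip u Hu) => form.
  have {}form := le_trans form (cauchy_schwarz ip_norm _ _).
  rewrite -(ler_pM2r Lu0) -expr2.
  apply: (@le_trans _ _ (c ^+ 2 * rnorm u ^+ 2)).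
    by rewrite -exprMn ler_pXn2r ?nnegrE ?mulr_ge0 ?rnorm_ge0// bc.
  by rewrite -!mulrA !ler_wpM2l// ler_pdivlMl//.
have [|||||p [Hp rep pM]] := @riesz_param R H ip ip_norm H0 U P (fun u => ip (L u) g)
  (c ^+ 2 / `|complex.Im l| * rnorm g) cH0 sU.
- by move=> a u v _ _; exact: projZD.
- by move=> a u v [Du _] [Dv _]; rewrite lL// ipDl ipZl.
- by move=> u _; exact: projH0.
- by rewrite mulr_ge0 ?rnorm_ge0.
- move=> u Uu; rewrite (le_trans (cauchy_schwarz ip_norm _ _))//.
  by rewrite mulrAC ler_wpM2r ?rnorm_ge0// coercive.
have [x Dx xp] := shift_surj ip_norm T_sa p l0.
exists x; rewrite xp; split=> //; apply: proj_eq => // h Hh.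
have cl0 : complex.Im (Num.conj l) != 0 by rewrite Im_conj oppr_eq0.
have [u Du uh] := shift_surj ip_norm T_sa h cl0.
have Uu : U u by rewrite /U/= /L uh.
have := rep u Uu; rewrite proj_ip// /L uh -xp ipBr ipZr -(sa_sym T_sa)//.
rewrite -ipZl -ipBl uh => gx.
by rewrite ipC gx -ipC.
Qed.

(** With [l = 1/z], the equation [(1 - z Q T) x = y] holds for
    [x = (l - T)^-1 (l y - h)] as soon as [h] in [H0] is such that
    [P x = P y]: then [h] is the missing component [P T x]. *)
Lemma FR_solve (z : C) :
  complex.Im z != 0 -> shift_le_on (Num.conj z^-1) ->
  exists2 b, 0 <= b & forall y, exists x,
    [/\ D x, x - z *: (T x - P (T x)) = y & rnorm (T x) <= b * rnorm y].
Proof.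
move=> z0 bnd; set l := z^-1; have l0 : complex.Im l != 0 by exact: Im_inv_neq0.
have [K K0 surj] := compressed_resolvent_surj l0 bnd.
pose m := `|complex.Im l|^-1.
have m0 : 0 <= m by rewrite invr_ge0.
have bm x : D x -> rnorm x <= m * rnorm (l *: x - T x).
  by move=> Dx; rewrite ler_pdivlMl ?normr_gt0//; exact: shift_norm_ge.
have nzl : z != 0 by apply: contraNneq z0 => ->.
have zl : z * l = 1 by rewrite mulfV.
pose A := m * rnorm l; have A0 : 0 <= A by rewrite mulr_ge0 ?rnorm_ge0.
pose B := K * (A + 1); have B0 : 0 <= B by rewrite mulr_ge0 ?addr_ge0.
exists (rnorm l * (A + m * B) + (rnorm l + B)).
  by rewrite !(addr_ge0, mulr_ge0, rnorm_ge0).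
move=> y.
have [x0 Dx0 x0E] := shift_surj ip_norm T_sa (l *: y) l0.
have Hg : H0 (P (x0 - y)) by exact: projH0.
have [x1 [Dx1 Hx1 Px1 bx1]] := surj _ Hg.
move hE : (l *: x1 - T x1) Hx1 bx1 => h Hx1 bx1.
move xE : (x0 - x1) => x.
have Dx : D x by rewrite -xE; exact: subspaceB.
have Tx : T x = l *: x - (l *: y - h).
  have := linear_onB (linear_on_shift T_sa l) Dx0 Dx1; rewrite xE x0E hE => <-.
  by rewrite subKr.
have PTx : P (T x) = h.
  rewrite Tx !projB !projZ (proj_id Hx1) -xE projB Px1 projB.
  by rewrite subKr subKr.
exists x; split=> //.
  rewrite PTx Tx; have -> : l *: x - (l *: y - h) - h = l *: (x - y).
    by rewrite -[LHS]addrA -opprD subrK scalerBr.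
  by rewrite scalerA zl scale1r subKr.
have nx0 : rnorm x0 <= A * rnorm y.
  by have := bm x0 Dx0; rewrite x0E rnormZ mulrA.
have nh : rnorm h <= B * rnorm y.
  apply: (le_trans bx1); rewrite -mulrA ler_wpM2l//.
  apply: (le_trans (proj_norm _)); apply: (le_trans (rnormB _ _)).
  by rewrite mulrDl mul1r lerD2r.
have nx1 : rnorm x1 <= m * B * rnorm y.
  by apply: (le_trans (bm x1 Dx1)); rewrite hE -mulrA ler_wpM2l.
rewrite Tx (le_trans (rnormB _ _))// mulrDl lerD//.
  rewrite rnormZ -mulrA ler_wpM2l ?rnorm_ge0// -xE (le_trans (rnormB _ _))//.
  by rewrite mulrDl lerD.
by rewrite (le_trans (rnormB _ _))// mulrDl rnormZ lerD2l.
Qed.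


(** * The FR-function *)

Local Notation Q v := (v - P v).

Lemma projQ v : P (Q v) = 0.
Proof. by rewrite projB (proj_id (projH0 v)) subrr. Qed.

Lemma ipQ u v : ip (Q u) (Q v) = ip u (Q v) /\ ip (Q u) (Q v) = ip (Q u) v.
Proof.
have PQ x y : ip (P x) (Q y) = 0.
  by rewrite ipC -(proj_ip (Q y) (projH0 x)) projQ ip0l rmorph0.
split; first by rewrite ipBl PQ subr0.
by rewrite [LHS]ipBr [ip (Q u) (P v)]ipC PQ rmorph0 subr0.
Qed.

Lemma normQ v : rnorm (Q v) <= 2 * rnorm v.
Proof. by have := rnormB v (P v); have := proj_norm v; lra. Qed.

(** The graph of [(1 - z Q T)^-1]; working with it lets existence, uniqueness
    and linearity of the inverse be established separately. *)
Definition FR_sol (z : C) y x : Prop := D x /\ x - z *: Q (T x) = y.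

Lemma FR_sol_lin z a y x y' x' : FR_sol z y x -> FR_sol z y' x' ->
  FR_sol z (a *: y + y') (a *: x + x').
Proof.
move=> [Dx <-] [Dx' <-]; split; first exact: subspaceZD.
have -> : Q (T (a *: x + x')) = a *: Q (T x) + Q (T x').
  by rewrite lT// projZD opprD addrACA -scalerBr.
rewrite scalerDr opprD addrACA [in RHS]scalerBr; congr (_ - _ + _).
by rewrite !scalerA mulrC.
Qed.

(** A solution of [x = z Q T x] has no component in [H0], so that
    [|x|^2 = z (T x, x)] with [(T x, x)] real. *)
Lemma FR_sol_uniq z y x x' : complex.Im z != 0 ->
  FR_sol z y x -> FR_sol z y x' -> x = x'.
Proof.
move=> z0 sx sx'; have := FR_sol_lin (-1) sx' sx.
rewrite !scaleN1r addNr addrC => -[Dd /subr0_eq d].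
apply/subr0_eq; move: (x - x') Dd d => {sx sx'} {}x Dx xE.
have Px : P x = 0 by rewrite xE projZ projQ scaler0.
apply: (ip_eq0 ip_norm).
have xx : ip x x = z * ip (T x) x.
  rewrite {1}xE ipZl; congr (_ * _).
  by have [q1 q2] := ipQ (T x) x; rewrite -q2 q1 Px subr0.
have r : complex.Im (ip (T x) x) = 0.
  have : complex.Im (ip (T x) x) = - complex.Im (ip (T x) x).
    by rewrite -Im_conj -ipC (sa_sym T_sa).
  by lra.
have rE : ip (T x) x = (complex.Re (ip (T x) x))%:C%C.
  by move: r; case: (ip (T x) x) => a b /= ->.
move: (f_equal (@complex.Im R) xx); rewrite rE [z * _]mulrC ImZ ipxx//= => /esym/eqP.
rewrite mulf_eq0 (negbTE z0) orbF => /eqP r0.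
by rewrite -(ipxx ip_norm) xx rE r0 mulr0.
Qed.

(** The identity [(f(w) h, g) - (h, f(z^* ) g) = (w - z) (Q T x, Q T y)], with
    [x = (1 - w Q T)^-1 h] and [y = (1 - z^* Q T)^-1 g]: the terms in [(T x, y)]
    cancel. Symmetry of [f] is the case [w = z], positivity of its imaginary
    part the case [w = z^*], [g = h]. *)
Lemma FR_form (z w : C) x y g h : H0 g -> H0 h ->
  FR_sol w h x -> FR_sol (Num.conj z) g y ->
  ip (P (T x)) g - ip h (P (T y)) = (w - z) * ip (Q (T x)) (Q (T y)).
Proof.
move=> Hg Hh [Dx hE] [Dy gE].
have -> : ip h (P (T y)) = ip h (T y).
  by rewrite ipC (proj_ip _ Hh) -ipC.
rewrite proj_ip// -{1}gE -{1}hE ipBr ipZr conjCK ipBl ipZl (sa_sym T_sa Dx Dy).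
case: (ipQ (T x) (T y)) => <- <-; ring.
Qed.

Hypothesis H0_case : finite_dimensional H0 \/ H0 `<=` D.

Lemma FR_sol_exists z : complex.Im z != 0 ->
  exists2 b, 0 <= b & forall y, exists2 x, FR_sol z y x &
    rnorm (T x) <= b * rnorm y.
Proof.
move=> z0; have l0 : complex.Im (Num.conj z^-1) != 0.
  by rewrite Im_conj oppr_eq0; exact: Im_inv_neq0.
have bnd : shift_le_on (Num.conj z^-1).
  case: H0_case => [fin|sub]; first exact: shift_le_on_finite_dim.
  exact: shift_le_on_subdomain.
have [b b0 sol] := FR_solve z0 bnd.
by exists b => // y; have [x [Dx xy bx]] := sol y; exists x.
Qed.

Lemma FR_domP z : complex.Im z != 0 -> FR_dom ip H0 T z.
Proof.
move=> z0; have nz : z != 0 by apply: contraNneq z0 => ->.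
have solE x y : D x -> z^-1 *: x - Q (T x) = y <-> FR_sol z (z *: y) x.
  move=> Dx; split=> [<-|[_ xy]].
    by split=> //; rewrite [RHS]scalerBr scalerA mulfV// scale1r.
  by apply: (scalerI nz); rewrite -xy [LHS]scalerBr scalerA mulfV// scale1r.
have [b _ sol] := FR_sol_exists z0.
split=> //; split.
  apply/seteqP; split=> [x [[_ [Dx _]] /= /solE]|_ ->].
    rewrite scaler0 => /(_ Dx) sx.
    apply: (FR_sol_uniq z0 sx); split; first exact: subspace0.
    by rewrite (linear_on0 sD lT) (proj_id (subspace0 sH0)) subrr scaler0 subrr.
  split; first by split=> //; split=> //; exact: subspace0.
  rewrite /= (linear_on0 sD lT) -[xget _ _]/(P 0) (proj_id (subspace0 sH0)).
  by rewrite scaler0 !subrr.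
apply/seteqP; split=> // y _.
have [x sx _] := sol (z *: y); exists x; first by split=> //; split=> //; case: sx.
by apply/solE => //; case: sx.
Qed.

Lemma FRE z h x : complex.Im z != 0 -> H0 h -> FR_sol z h x ->
  odom (FR ip H0 T z) h /\ FR ip H0 T z h = P (T x).
Proof.
move=> z0 Hh sx; have [Dx xh] := sx.
pose A := (1 - z *: ((1 - P) \o T))%OP.
have Ph := proj_id Hh.
have dA u : odom A u <-> D u by split=> [[_ []]|].
have AE u : A u = u - z *: Q (T u) by [].
have inv_h : op_inv A (P h) = x.
  rewrite -[LHS]/(xget 0 [set u | odom A u /\ A u = P h]) Ph.
  apply: xget_unique => [|u [/dA Du uh]]; first by split; [exact/dA|rewrite AE].
  by apply: (FR_sol_uniq z0 _ sx); split=> //; rewrite -AE.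
split; last by rewrite -[LHS]/(P (T (op_inv A (P h)))) inv_h.
have rng : op_range A (P h) by exists x; [exact/dA|rewrite Ph AE].
have Dinv : D (op_inv A (P h)) by rewrite inv_h.
exact: (conj (conj I (conj rng (conj Dinv I))) Hh).
Qed.

Lemma FR_domE z : complex.Im z != 0 -> odom (FR ip H0 T z) = H0.
Proof.
move=> z0; apply/seteqP; split=> [h [] //|h Hh].
have [b _ /(_ h)[x sx _]] := FR_sol_exists z0.
by have [] := FRE z0 Hh sx.
Qed.

Lemma FR_bounded z : complex.Im z != 0 -> bounded_op H0 (FR ip H0 T z).
Proof.
move=> z0; have dE := FR_domE z0.
have [b b0 sol] := FR_sol_exists z0.
split=> //.
- split; first by rewrite dE.
  rewrite dE => a h h' Hh Hh'.
  have [[x sx _] [x' sx' _]] := (sol h, sol h').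
  have sxx' := FR_sol_lin a sx sx'.
  have [_ ->] := FRE z0 Hh sx; have [_ ->] := FRE z0 Hh' sx'.
  have [_ ->] := FRE z0 (subspaceZD a sH0 Hh Hh') sxx'.
  by rewrite lT ?projZD//; [case: sx|case: sx'].
- move=> h Hh; have [x sx _] := sol h.
  by have [_ ->] := FRE z0 Hh sx; exact: projH0.
- exists b%:C%C => h Hh; have [x sx bx] := sol h.
  have [_ ->] := FRE z0 Hh sx.
  rewrite !rnormE -rmorphM/= lecR.
  exact: (le_trans (proj_norm _) bx).
Qed.

Lemma FR_adjointP z h g : complex.Im z != 0 -> H0 h -> H0 g ->
  ip (FR ip H0 T z h) g = ip h (FR ip H0 T (Num.conj z) g).
Proof.
move=> z0 Hh Hg.
have zc0 : complex.Im (Num.conj z) != 0 by rewrite Im_conj oppr_eq0.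
have [_ _ /(_ h)[x sx _]] := FR_sol_exists z0.
have [_ _ /(_ g)[y sy _]] := FR_sol_exists zc0.
have [_ ->] := FRE z0 Hh sx; have [_ ->] := FRE zc0 Hg sy.
by apply/subr0_eq; rewrite (FR_form Hg Hh sx sy) subrr mul0r.
Qed.

Lemma FR_adjoint z : complex.Im z != 0 ->
  op_eq (adjoint ip H0 (FR ip H0 T z)) (FR ip H0 T (Num.conj z)).
Proof.
move=> z0; have zc0 : complex.Im (Num.conj z) != 0 by rewrite Im_conj oppr_eq0.
have [_ _ into _] := FR_bounded zc0.
have adj y : H0 y -> [set w | H0 w /\ forall x, odom (FR ip H0 T z) x ->
    ip (FR ip H0 T z x) y = ip x w] (FR ip H0 T (Num.conj z) y).
  move=> Hy; split; first exact: into.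
  by rewrite FR_domE// => x Hx; exact: FR_adjointP.
split.
  rewrite (FR_domE zc0); apply/seteqP; split=> [y []//|y Hy].
  by split=> //; exists (FR ip H0 T (Num.conj z) y); exact: adj.
move=> y [Hy _]; apply: xget_unique; first exact: adj.
move=> w [Hw wE]; apply/subr0_eq/(ip_eq0 ip_norm).
have [Hf fE] := adj y Hy.
set d := w - _; have Hd : H0 d by exact: subspaceB.
have dd : odom (FR ip H0 T z) d by rewrite FR_domE.
by rewrite {2}/d ipBr -wE// -fE// subrr.
Qed.

Lemma FR_Im_pos z : complex.Im z != 0 ->
  op_pos ip (('Im z)^-1 *: op_Im ip H0 (FR ip H0 T z))%OP.
Proof.
move=> z0 h [Hh _]; rewrite FR_domE// in Hh.
have zc0 : complex.Im (Num.conj z) != 0 by rewrite Im_conj oppr_eq0.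
have Hy : odom (adjoint ip H0 (FR ip H0 T z)) h.
  by have [-> _] := FR_adjoint z0; rewrite FR_domE.
have [_ /(_ h Hy) adjE] := FR_adjoint z0.
rewrite -[X in ip X _]/(('Im z)^-1 *: ((2 * 'i)^-1 *:
  (FR ip H0 T z h - adjoint ip H0 (FR ip H0 T z) h))) adjE.
have [_ _ /(_ h)[x sx _]] := FR_sol_exists z0.
rewrite !ipZl ipBl [ip (FR ip H0 T (Num.conj z) h) h]ipC -FR_adjointP// -ipC.
have [_ ->] := FRE z0 Hh sx.
have sx' : FR_sol (Num.conj (Num.conj z)) h x by rewrite conjCK.
rewrite (FR_form Hh Hh sx sx') ipxx//.
have -> : z - Num.conj z = 2 * 'i * 'Im z.
  rewrite {1 2}[z]Crect conjC_rect ?Creal_Re ?Creal_Im//; ring.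
have Imz : 'Im z != 0 by exact/nonrealE.
rewrite [X in 0 <= X](_ : _ = (rnorm (Q (T x)) ^+ 2)%:C%C); last first.
  by field; rewrite Imz neq0Ci.
by rewrite ler0c sqr_ge0.
Qed.

Lemma FR_sol_shift z w y x : FR_sol z y x ->
  FR_sol w (y - (w - z) *: Q (T x)) x.
Proof.
move=> [Dx <-]; split=> //.
by rewrite -addrA -opprD -scalerDl [z + _]addrC subrK.
Qed.

(** With [A = Q T (1 - z Q T)^-1], the second resolvent identity used twice
    expands [P T (1 - w Q T)^-1] to first order around [z], with remainder
    [(w - z)^2 P T (1 - w Q T)^-1 A^2]; and it bounds [T (1 - w Q T)^-1] by
    twice the bound at [z] when [w] is close to [z]. *)
Lemma FR_analytic : analytic_op H0 (@nonreal R) (FR ip H0 T).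
Proof.
move=> z /nonrealE z0.
have [b b0 sol] := FR_sol_exists z0.
have /choice[S SP] : forall y, exists x, FR_sol z y x.
  by move=> y; have [x sx _] := sol y; exists x.
have bnd y x : FR_sol z y x -> rnorm (T x) <= b * rnorm y.
  by move=> sx; have [x' sx'] := sol y; rewrite (FR_sol_uniq z0 sx sx').
pose A y := Q (T (S y)).
have TSlin a y y' : T (S (a *: y + y')) = a *: T (S y) + T (S y').
  rewrite (FR_sol_uniq z0 (SP _) (FR_sol_lin a (SP y) (SP y'))) lT//.
    by case: (SP y).
  by case: (SP y').
have Alin a y y' : A (a *: y + y') = a *: A y + A y'.
  by rewrite /A TSlin projZD opprD addrACA -scalerBr.
have bA y : rnorm (A y) <= 2 * b * rnorm y.
  by have := normQ (T (S y)); have := bnd _ _ (SP y); rewrite -/(A y); lra.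
exists (Operator H0 (fun h => P (T (S (A h))))).
  split=> //.
  - split=> // a h h' _ _; rewrite -[LHS]/(P (T (S (A (a *: h + h'))))).
    by rewrite Alin TSlin projZD.
  - by move=> h _; exact: projH0.
  exists (b * (2 * b))%:C%C => h _; rewrite -[X in `|X|]/(P (T (S (A h)))).
  rewrite !rnormE -rmorphM/= lecR (le_trans (proj_norm _))//.
  by rewrite (le_trans (bnd _ _ (SP _)))// -mulrA ler_wpM2l.
move=> _e e0; have := e0; have := RRe_real (gtr0_real e0).
move: (complex.Re _e) => e <- {_e e0}; rewrite ltr0c => e0.
(* d1 makes the perturbation of the right-hand side at most half of it, d2
   makes the remainder at most e *)
pose d1 := (4 * b + 1)^-1; pose d2 := e / (8 * b ^+ 3 + 1).
have b1 : 0 < 4 * b + 1 by rewrite ltr_wpDl// mulr_ge0.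
have b3 : 0 < 8 * b ^+ 3 + 1 by rewrite ltr_wpDl// mulr_ge0// exprn_ge0.
exists (Num.min `|complex.Im z| (Num.min d1 d2))%:C%C.
  by rewrite ltr0c !lt_min normr_gt0 z0 invr_gt0 b1 divr_gt0.
move=> w wz; rewrite rnormE ltcR !lt_min => /and3P[wz0 wz1 wz2].
have w0 : complex.Im w != 0.
  apply: contraTneq wz0 => w0; rewrite -leNgt.
  by have := Im_le_rnorm (w - z); rewrite ImD ImN w0 add0r normrN.
set t := w - z in wz0 wz1 wz2 *.
have t0 : t != 0 by rewrite subr_eq0.
have bw v x : FR_sol w v x -> rnorm (T x) <= 2 * b * rnorm v.
  move=> sx; have := bnd _ _ (FR_sol_shift z sx).
  have y_le : rnorm (v - (z - w) *: Q (T x)) <=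
      rnorm v + rnorm t * (2 * rnorm (T x)).
    apply: (le_trans (rnormB _ _)); rewrite lerD2l rnormZ [rnorm (z - w)]rnormBC.
    by rewrite ler_wpM2l ?rnorm_ge0 ?normQ.
  move=> /le_trans/(_ (ler_wpM2l b0 y_le)).
  have : rnorm t * (4 * b) * rnorm (T x) <= 1 * rnorm (T x).
    rewrite ler_wpM2r ?rnorm_ge0//.
    move: wz1; rewrite /d1 -[ltRHS]mul1r ltr_pdivlMr// => wz1.
    by have := rnorm_ge0 t; lra.
  by lra.
move=> h Hh.
have [_ _ /(_ (A (A h)))[x3 sx3 _]] := FR_sol_exists w0.
have := FR_sol_lin t sx3 (FR_sol_shift w (SP (A h))).
rewrite -/(A (A h)) -/t addrC subrK => sx4.
have := FR_sol_lin t sx4 (FR_sol_shift w (SP h)).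
rewrite -/(A h) -/t addrC subrK => sx.
have [_ fw] := FRE w0 Hh sx; have [_ fz] := FRE z0 Hh (SP h).
rewrite -[X in `|X|]/(t^-1 *: (FR ip H0 T w h - FR ip H0 T z h) - P (T (S (A h)))).
have [[Dx3 _] [Dx4 _]] := (sx3, sx4).
have [[DSh _] [DSA _]] := (SP h, SP (A h)).
rewrite fw fz lT// projZD addrK scalerA mulVf// scale1r lT// projZD addrK.
rewrite !rnormE -rmorphM/= lecR rnormZ.
apply: (@le_trans _ _ (rnorm t * (8 * b ^+ 3 * rnorm h))).
  rewrite ler_wpM2l ?rnorm_ge0// (le_trans (proj_norm _))//.
  rewrite (le_trans (bw _ _ sx3))//.
  have -> : 8 * b ^+ 3 * rnorm h = 2 * b * (2 * b * (2 * b * rnorm h)) by ring.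
  by rewrite !ler_wpM2l ?mulr_ge0// (le_trans (bA _))// ler_wpM2l ?mulr_ge0.
rewrite mulrA ler_wpM2r ?rnorm_ge0//.
move: wz2; rewrite /d2 ltr_pdivlMr// => /ltW; apply: le_trans.
by rewrite ler_wpM2l ?rnorm_ge0// lerDl.
Qed.

Lemma FR_nevanlinna : nevanlinna ip H0 (FR_dom ip H0 T) (FR ip H0 T).
Proof.
split.
- by move=> z /nonrealE; exact: FR_domP.
- by move=> z /nonrealE; exact: FR_bounded.
- exact: FR_analytic.
- by move=> z /nonrealE; exact: FR_adjoint.
- by move=> z /nonrealE; exact: FR_Im_pos.
Qed.

End Compression.

Theorem theorem3p1 (R : realType) (H : completeNormedModType R[i])
    (ip : {dot H for (@Num.conj R[i])}) (T : operator H) (H0 : set H)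
    (ip_norm : induces_norm ip)
    (T_sa : self_adjoint ip T)
    (H0_subspace : linear_subspace H0) (H0_closed : closed H0)
    (H0_case : finite_dimensional H0 \/ H0 `<=` odom T) :
  nevanlinna ip H0 (FR_dom ip H0 T) (FR ip H0 T).
Proof. exact: FR_nevanlinna. Qed.
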